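(* Let $R$ be a ring with proper involution $*$, let $m\ge 1$ be an integer and let $a,b\in R^{\overline{W}_m}$. If $ab=ba$ and $a^*b=ba^*$, then $ab\in R^{\overline{W}_m}$. In this case, $$(ab)^{\overline{W}_m}=a^{\overline{W}_m}b^{\overline{W}_m}=b^{\overline{W}_m}a^{\overline{W}_m}.$$
   Context: Rings are associative with identity and $\mathbb{N}$ is the set of positive integers. An involution $*$ on $R$ satisfies $(x+y)^*=x^*+y^*$, $(xy)^*=y^*x^*$, $(x^* )^*=x$; it is proper if $x^*x=0$ implies $x=0$. An element $a\in R$ has an $m$-weak group inverse if there exist $x\in R$ and $k\in\mathbb{N}$ with $ax^2=x$, $xa^{k+1}=a^k$ and $(a^k)^*a^{m+1}x=(a^k)^*a^m$; such an $x$ is unique if it exists and is denoted $a^{\overline{W}_m}$. $R^{\overline{W}_m}$ is the set of elements of $R$ having an $m$-weak group inverse. *)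

(* Defs.v *)
From mathcomp Require Import all_boot all_algebra.
From mathcomp Require Import boolp classical_sets.

Set Implicit Arguments.
Unset Strict Implicit.
Unset Printing Implicit Defensive.

Import GRing.Theory.
Local Open Scope ring_scope.

(* Rings are [pzRingType]s: associative with identity, not assumed nontrivial. *)

Record ring_involution (R : pzRingType) (star : R -> R) : Prop :=
  RingInvolution {
    starD : forall x y, star (x + y) = star x + star y;
    starM : forall x y, star (x * y) = star y * star x;
    starK : forall x, star (star x) = x }.

Definition proper_involution (R : pzRingType) (star : R -> R) : Prop :=
  ring_involution star /\ (forall x, star x * x = 0 -> x = 0).

Definition is_mweak_group_inverse (R : pzRingType) (star : R -> R) (m : nat)
    (a x : R) : Prop :=
  exists k : nat,
    [/\ (0 < k)%N,
        a * x ^+ 2 = x,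
        x * a ^+ k.+1 = a ^+ k &
        star (a ^+ k) * a ^+ m.+1 * x = star (a ^+ k) * a ^+ m].

Definition has_mweak_group_inverse (R : pzRingType) (star : R -> R) (m : nat)
    (a : R) : Prop :=
  exists x, is_mweak_group_inverse star m a x.

(* The junk value 0 is returned when [a] has no m-weak group inverse;
   otherwise the chosen inverse is the only one, by
   [mweak_group_inverse_unique] below. *)
Definition mweak_group_inverse (R : pzRingType) (star : R -> R) (m : nat)
    (a : R) : R :=
  xget 0 [set x | is_mweak_group_inverse star m a x]%classic.

Lemma mweak_group_inverse_unique (R : pzRingType) (star : R -> R) (m : nat)
    (a x y : R) :
  proper_involution star ->
  is_mweak_group_inverse star m a x -> is_mweak_group_inverse star m a y ->
  x = y.
Proof.
move=> [[sD sM sK] sP].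
have factor z n : a * z ^+ 2 = z -> a ^+ n * z ^+ n.+1 = z.
  move=> az; elim: n => [|n IH]; first by rewrite expr0 mul1r expr1.
  by rewrite exprSr -[n.+2]/(2 + n)%N exprD -mulrA (mulrA a) az -exprS.
have shift n p t : star (a ^+ n) * t = 0 -> star (a ^+ (n + p)) * t = 0.
  by move=> h; rewrite exprD sM -mulrA h mulr0.
move=> [k [_ xa xk xs]] [l [_ ya yl ys]].
have xyw : x - y = a ^+ (k + l) * (x ^+ (k + l).+1 - y ^+ (k + l).+1).
  by rewrite mulrBr !factor.
have xs0 : star (a ^+ (k + l)) * (a ^+ m.+1 * x - a ^+ m) = 0.
  by apply: shift; rewrite mulrBr mulrA xs subrr.
have ys0 : star (a ^+ (k + l)) * (a ^+ m.+1 * y - a ^+ m) = 0.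
  by rewrite addnC; apply: shift; rewrite mulrBr mulrA ys subrr.
have d0 : star (a ^+ (k + l)) * (a ^+ m.+1 * (x - y)) = 0.
  have -> : a ^+ m.+1 * (x - y)
      = (a ^+ m.+1 * x - a ^+ m) - (a ^+ m.+1 * y - a ^+ m).
    by rewrite mulrBr opprB addrA subrK.
  by rewrite mulrBr xs0 ys0 subrr.
have e0 : a ^+ m.+1 * (x - y) = 0.
  apply: sP.
  have -> : star (a ^+ m.+1 * (x - y))
      = star (a ^+ m.+1 * (x ^+ (k + l).+1 - y ^+ (k + l).+1))
        * star (a ^+ (k + l)).
    by rewrite -sM {1}xyw !mulrA -!exprD addnC.
  by rewrite -mulrA d0 mulr0.
have cancel n w : x ^+ n * (a ^+ n * (a ^+ k * w)) = a ^+ k * w.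
  elim: n => [|n IH]; first by rewrite !expr0 !mul1r.
  rewrite (exprSr x) (exprSr a) -!mulrA (mulrA a) -exprS.
  have comm : a ^+ n * (a ^+ k.+1 * w) = a ^+ k.+1 * (a ^+ n * w).
    by rewrite !mulrA -!exprD addnC.
  rewrite comm (mulrA x) xk -[RHS]IH; congr (_ * _).
  by rewrite !mulrA -!exprD addnC.
apply/eqP; rewrite -subr_eq0 xyw exprD -mulrA -(cancel m.+1).
by rewrite (mulrA (a ^+ k)) -exprD -xyw e0 mulr0.
Qed.

(* Main.v *)
Require Import Defs.
From mathcomp Require Import all_boot all_algebra.
From mathcomp Require Import classical_sets.

Set Implicit Arguments.
Unset Strict Implicit.
Unset Printing Implicit Defensive.

Import GRing.Theory.
Local Open Scope ring_scope.

(* If c commutes with a and star a, then c commutes with the m-weak group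
   inverse x of a: the commutator d = c x - x c lies in a^k R and satisfies
   star (a^k) a^(m+1) d = 0, so properness gives a^(m+1) d = 0, and left
   multiplication by a is injective on a^k R. Under the hypotheses b and star b
   both commute with a and star a, hence with x; so x in turn commutes with the
   m-weak group inverse y of b, and x y satisfies the defining equations for
   a b factor by factor. *)

Lemma ring_involutionX (R : pzRingType) (star : R -> R) (a : R) (n : nat) :
  ring_involution star -> (0 < n)%N -> star (a ^+ n) = star a ^+ n.
Proof.
move=> [_ sM _]; case: n => // n _; elim: n => [|n IH]; first by rewrite !expr1.
by rewrite exprS sM IH -exprSr.
Qed.

Lemma comm_star (R : pzRingType) (star : R -> R) (x y : R) :
  ring_involution star -> GRing.comm x y -> GRing.comm (star x) (star y).
Proof. by move=> [_ sM _] xy; rewrite /GRing.comm -!sM xy. Qed.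

Section FixedExponent.

Variables (R : pzRingType) (star : R -> R) (m : nat) (a x : R) (k : nat).
Hypotheses (star_proper : proper_involution star) (k_gt0 : (0 < k)%N).
Hypotheses (axx : a * x ^+ 2 = x) (xak : x * a ^+ k.+1 = a ^+ k).
Hypothesis saax : star (a ^+ k) * a ^+ m.+1 * x = star (a ^+ k) * a ^+ m.

(** Iterating [axx] places [x] in [a ^+ n] R for every [n]. *)
Lemma mweak_outer_factor n : a ^+ n * x ^+ n.+1 = x.
Proof.
elim: n => [|n IH]; first by rewrite mul1r expr1.
by rewrite exprSr -[n.+2]/(2 + n)%N exprD -mulrA (mulrA a) axx -exprS.
Qed.

(** By [xak], [x] undoes left multiplication by [a] on the right ideal [a ^+ k] R, which [a] maps
    into itself. *)
Lemma mweak_left_cancel n w : x ^+ n * (a ^+ n * (a ^+ k * w)) = a ^+ k * w.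
Proof.
elim: n => [|n IH]; first by rewrite !expr0 !mul1r.
rewrite -[RHS]IH [x ^+ _]exprSr -mulrA; congr (_ * _).
rewrite !(mulrA (a ^+ _)) -!exprD addSn (addnC n) -addSn exprD.
by rewrite !mulrA xak -exprD.
Qed.

(** The exponent of an m-weak group inverse may be enlarged, so two elements can be given a common
    one. *)
Lemma mweak_exponentD n :
  x * a ^+ (k + n).+1 = a ^+ (k + n) /\
  star (a ^+ (k + n)) * a ^+ m.+1 * x = star (a ^+ (k + n)) * a ^+ m.
Proof.
have [[_ sM _] _] := star_proper.
split; first by rewrite -addSn exprD mulrA xak -exprD.
by rewrite exprD sM -2!mulrA (mulrA (star (a ^+ k))) saax mulrA.
Qed.

Lemma mweak_comm c :
  GRing.comm c a -> GRing.comm c (star a) -> GRing.comm c x.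
Proof.
have [sinv sP] := star_proper; have [_ sM _] := sinv.
move=> ca csa; set d := c * x - x * c.
have cak := commrX k ca; have cam := commrX m ca.
have cam1 := commrX m.+1 ca.
have csak : GRing.comm c (star (a ^+ k)).
  by rewrite ring_involutionX //; apply: commrX.
(* Expand [x] as [a ^+ k * x ^+ k.+1] in both terms of [d] and move [c] past [a ^+ k]. *)
have [w dE] : exists w, d = a ^+ k * w.
  exists (c * x ^+ k.+1 - x ^+ k.+1 * c).
  by rewrite mulrBr !mulrA -cak -mulrA mweak_outer_factor.
(* Both terms reduce to [star (a ^+ k) * a ^+ m * c]: in the first, [c] is moved to the far left so
   that [saax] applies, then moved back. *)
have sd0 : star (a ^+ k) * (a ^+ m.+1 * d) = 0.
  rewrite /d !mulrBr !mulrA saax -(commrM csak cam1) -(commrM csak cam).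
  by rewrite -!mulrA (mulrA (star _)) saax subrr.
(* Since [a ^+ m.+1 * d = a ^+ k * (a ^+ m.+1 * w)], its star ends in the factor [star (a ^+ k)], to
   which [sd0] applies. *)
have ad0 : a ^+ m.+1 * d = 0.
  apply: sP; rewrite {1}dE (mulrA _ (a ^+ k)) -exprD addnC exprD -mulrA.
  by rewrite sM -mulrA sd0 mulr0.
apply/eqP; rewrite -subr_eq0 -/d dE -(mweak_left_cancel m.+1).
by rewrite -dE ad0 mulr0.
Qed.

End FixedExponent.

Lemma is_mweak_group_inverse_comm (R : pzRingType) (star : R -> R) (m : nat)
    (a x c : R) :
  proper_involution star -> is_mweak_group_inverse star m a x ->
  GRing.comm c a -> GRing.comm c (star a) -> GRing.comm c x.
Proof. by move=> sp [k [k0 axx xak saax]]; apply: mweak_comm saax _. Qed.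

Lemma comm_mulrACA (R : pzRingType) (p q r s : R) :
  GRing.comm q r -> p * q * (r * s) = p * r * (q * s).
Proof. by move=> qr; rewrite -!mulrA (mulrA q) qr -mulrA. Qed.

Lemma is_mweak_group_inverseM (R : pzRingType) (star : R -> R) (m : nat)
    (a b x y : R) :
  proper_involution star ->
  is_mweak_group_inverse star m a x -> is_mweak_group_inverse star m b y ->
  GRing.comm a b -> GRing.comm (star a) b ->
  is_mweak_group_inverse star m (a * b) (x * y) /\ GRing.comm x y.
Proof.
move=> sp ax bY ab sab; have [sinv _] := sp; have [_ sM sK] := sinv.
(* Apply the involution to [sab]. *)
have asb : GRing.comm a (star b) by rewrite -[a]sK; apply: comm_star.
have sasb := comm_star sinv ab.
have xb : GRing.comm x b.
  exact/commr_sym/(is_mweak_group_inverse_comm sp ax); apply: commr_sym.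
have xsb : GRing.comm x (star b).
  exact/commr_sym/(is_mweak_group_inverse_comm sp ax); apply: commr_sym.
have ay := is_mweak_group_inverse_comm sp bY ab asb.
have xy := is_mweak_group_inverse_comm sp bY xb xsb.
split=> //; case: ax bY => [k [k0 axx xak saax]] [l [l0 byy ybl sbby]].
have [xaN saN] := mweak_exponentD sp xak saax l.
have [ybN sbN] := mweak_exponentD sp ybl sbby k.
rewrite addnC in ybN sbN; set N := (k + l)%N in xaN saN ybN sbN.
have N0 : (0 < N)%N by rewrite addn_gt0 k0.
have abX n : (a * b) ^+ n = a ^+ n * b ^+ n by apply: exprMn_comm.
exists N; split=> //.
- have bx2 : GRing.comm b (x ^+ 2) by apply: commrX; apply: commr_sym.
  by rewrite exprMn_comm // comm_mulrACA // axx byy.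
- have yaN : GRing.comm y (a ^+ N.+1) by apply: commrX; apply: commr_sym.
  by rewrite !abX comm_mulrACA // xaN ybN.
- have sbN_a n : GRing.comm (star (b ^+ N)) (a ^+ n).
    by rewrite ring_involutionX //; apply: commrX; apply/commr_sym/commrX.
  have x_sbN : GRing.comm x (star (b ^+ N)).
    by rewrite ring_involutionX //; apply: commrX.
  (* The reversal of factors by [star] is offset by swapping the commuting powers first. *)
  have sabN : star (a ^+ N * b ^+ N) = star (a ^+ N) * star (b ^+ N).
    rewrite -sM; congr star.
    by apply/commrX/commr_sym/commrX.
  (* Regroup the left side as [star (a ^+ N) * a ^+ m.+1 * x] times
     [star (b ^+ N) * b ^+ m.+1 * y]. *)
  rewrite !abX sabN (comm_mulrACA _ _ (sbN_a _)) (comm_mulrACA _ _ (sbN_a _)).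
  rewrite comm_mulrACA ?saN ?sbN //.
  by apply/commr_sym/commrM => //; apply: commrX.
Qed.

(** Uniqueness forces the choice made by [xget], so the default [0] is never reached without being
    the inverse itself. *)
Lemma mweak_group_inverseE (R : pzRingType) (star : R -> R) (m : nat)
    (a x : R) :
  proper_involution star -> is_mweak_group_inverse star m a x ->
  mweak_group_inverse star m a = x.
Proof.
move=> sp ax; apply: xget_unique => // y ay.
exact: mweak_group_inverse_unique ay ax.
Qed.

Theorem theorem2p11 (R : pzRingType) (star : R -> R)
    (star_proper : proper_involution star) (m : nat) (m_ge1 : (1 <= m)%N)
    (a b : R)
    (a_inv : has_mweak_group_inverse star m a)
    (b_inv : has_mweak_group_inverse star m b)
    (ab_comm : a * b = b * a) (sab_comm : star a * b = b * star a) :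
  has_mweak_group_inverse star m (a * b) /\
  (mweak_group_inverse star m (a * b)
     = mweak_group_inverse star m a * mweak_group_inverse star m b /\
   mweak_group_inverse star m a * mweak_group_inverse star m b
     = mweak_group_inverse star m b * mweak_group_inverse star m a).
Proof.
case: a_inv b_inv => [x ax] [y bY].
have [abxy xy] := is_mweak_group_inverseM star_proper ax bY ab_comm sab_comm.
split; first by exists (x * y).
rewrite (mweak_group_inverseE star_proper ax).
rewrite (mweak_group_inverseE star_proper bY).
by rewrite (mweak_group_inverseE star_proper abxy).
Qed.
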